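(* Let $n$ be a positive integer and $d$ a non-negative integer. Let $X \subseteq \mathbb{R}^n$ be a set with non-empty interior and let $C$ be a closed convex cone satisfying $\Sigma_{n,2d} \subseteq C \subseteq P_{n,2d}(X)$. Then $$\operatorname{sxdeg}(C) \ge \binom{n+d}{n}.$$
   Context: $\mathbb{R}[\mathbf{x}]_{2d}$ denotes the finite-dimensional vector space of polynomials in $n$ variables $\mathbf{x}=(x_1,\ldots,x_n)$ with real coefficients and degree at most $2d$ (with its Euclidean topology). A polynomial is SOS if it is a sum of finitely many squares of polynomials in $\mathbb{R}[\mathbf{x}]$. $\Sigma_{n,2d} := \{f \in \mathbb{R}[\mathbf{x}]_{2d} : f \text{ is SOS}\}$, and for $X\subseteq\mathbb{R}^n$, $P_{n,2d}(X) := \{ f \in \mathbb{R}[\mathbf{x}]_{2d} : f \ge 0 \text{ on } X\}$. $\mathcal{S}^j$ is the vector space of real symmetric $j\times j$ matrices and $\mathcal{S}_+^j\subseteq \mathcal{S}^j$ is the cone of positive semidefinite ones. For a closed convex cone $K$ in a finite-dimensional real vector space $E$, a subset $S$ of a real vector space $V$ has a $K$-lift if $S = \pi(K \cap H)$ for some affine subspace $H$ of $E$ and some linear map $\pi: E \to V$. The semidefinite extension degree $\operatorname{sxdeg}(S)$ is the smallest positive integer $j$ such that $S$ has an $(\mathcal{S}_+^j)^m$-lift for some finite positive integer $m$, where $(\mathcal{S}_+^j)^m = \mathcal{S}_+^j\times\cdots\times\mathcal{S}_+^j$ ($m$ factors); $\operatorname{sxdeg}(S):=\infty$ if there is no such $j$.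 *)

(* Defs.v *)
(* MathComp + MathComp-Analysis.  [mpoly] has to be imported before the
   analysis libraries: the opposite order raises a notation-level clash. *)
From mathcomp Require Import all_boot all_order all_algebra.
From mathcomp Require Import mpoly.
From mathcomp Require Import boolp classical_sets reals ereal topology.
From mathcomp Require Import normedtype convex.

Set Implicit Arguments.
Unset Strict Implicit.
Unset Printing Implicit Defensive.

Import Order.TTheory GRing.Theory Num.Theory.
Import numFieldNormedType.Exports.

Local Open Scope classical_set_scope.
Local Open Scope ring_scope.

(* [msize p] is 1 + deg p, and 0 for p = 0. *)
Definition polys_le (R : realType) (n k : nat) : set {mpoly R[n]} :=
  [set f | (msize f <= k.+1)%N].

Definition is_sos (R : realType) (n : nat) (f : {mpoly R[n]}) : Prop :=
  exists s : seq {mpoly R[n]}, f = \sum_(g <- s) g ^+ 2.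

Definition sos_polys (R : realType) (n k : nat) : set {mpoly R[n]} :=
  [set f | polys_le k f /\ is_sos f].

Definition nonneg_polys (R : realType) (n k : nat) (X : set 'rV[R]_n) :
    set {mpoly R[n]} :=
  [set f | polys_le k f /\ forall x, X x -> 0 <= f.@[fun i => x ord0 i]].

Definition coef_row (R : realType) (n k : nat) (f : {mpoly R[n]}) :
    'rV[R]_#|{: 'X_{1..n < k.+1}}| :=
  \row_i f@_(enum_val i : 'X_{1..n < k.+1}).

(* [coef_row k] restricts to a linear isomorphism from the space of polynomials
   of degree at most k onto R^N, so for C contained in that space this is
   closedness in its Euclidean topology. *)
Definition closed_polys (R : realType) (n k : nat) (C : set {mpoly R[n]}) :
    Prop :=
  closed [set coef_row k f | f in C].

Definition convex_cone (R : realType) (V : lmodType R) (C : set V) : Prop :=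
  [/\ C !=set0,
      forall (a : R) (x : V), 0 <= a -> C x -> C (a *: x)
    & convex_set (C : set (convex_lmodType V))].

Definition affine_subspace (R : realType) (E : vectType R) (H : set E) : Prop :=
  exists (a : E) (W : {vspace E}), H = [set a + w | w in [set` W]].

Definition has_lift (R : realType) (E : vectType R) (K : set E)
    (V : lmodType R) (S : set V) : Prop :=
  exists (H : set E) (pi : {linear E -> V}),
    affine_subspace H /\ S = pi @` (K `&` H).

Definition symmx (R : realType) (j : nat) : {vspace 'M[R]_j} :=
  fixedSpace (linfun (@trmx R j j)).

Lemma mem_symmx (R : realType) (j : nat) (A : 'M[R]_j) :
  reflect (A^T = A) (A \in symmx R j).
Proof. by apply: (iffP fixedSpaceP); rewrite lfunE. Qed.

Definition psd_cone (R : realType) (j : nat) : set (subvs_of (symmx R j)) :=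
  [set A | forall v : 'cV[R]_j, 0 <= (v^T *m vsval A *m v) ord0 ord0].

Definition psd_prod (R : realType) (j m : nat) :
    set {ffun 'I_m -> subvs_of (symmx R j)} :=
  [set A | forall i, psd_cone (A i)].

Definition has_sdp_lift (R : realType) (V : lmodType R) (S : set V) (j : nat) :
    Prop :=
  (0 < j)%N /\ exists m : nat, (0 < m)%N /\ has_lift (@psd_prod R j m) S.

(* The degree lives in the extended reals because they provide both the
   embedded naturals and +oo. *)
Definition sxdeg (R : realType) (V : lmodType R) (S : set V) : \bar R :=
  if pselect (exists j, `[< has_sdp_lift S j >]) is left hj
  then (ex_minn hj)%:R%:E else +oo%E.

(* Main.v *)
Require Import Defs.
From mathcomp Require Import all_boot all_order all_algebra.
From mathcomp Require Import mpoly.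
From mathcomp Require Import boolp classical_sets reals ereal topology.
From mathcomp Require Import normedtype convex.
From mathcomp Require Import zify ring lra.
Import Order.TTheory GRing.Theory Num.Theory.
Import numFieldNormedType.Exports.

(** Suppose C is the image under a linear map pi of an affine slice L of a
    product of m copies of the cone of positive semidefinite j x j matrices.
    Each point x of X gives the linear functional A |-> pi(A)(x), which is
    nonnegative on L because C consists of polynomials nonnegative on X.  Its
    zeros in L form a face of L, and faces of such a slice are cut out by
    kernels: there are subspaces U(x,1), ..., U(x,m) of R^j such that, for A in
    L, pi(A)(x) = 0 if and only if the l-th block of A annihilates U(x,l) for
    all l ([psd_lift_face]).

    If j were smaller than N = 'C(n + d, n), the dimension of the space of
    polynomials of degree at most d, then any j points would lie on the zero
    set of a nonzero polynomial p of degree at most d ([interpolation]), and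
    p ^+ 2 would be pi(A) for some A in L.  The j points can be chosen inside a
    Zariski-dense subset Y of X so that, for every l at once, the spaces U(y,l)
    of the chosen points y span all the U(x,l) with x in Y
    ([spanning_sample]).  Choosing one point at a time suffices, whatever m
    is, since a new point outside finitely many thin sets enlarges every
    one of the m spans that is not yet complete, and no subspace of R^j can
    grow more than j times.  The blocks of A annihilate U(y,l) for the chosen
    points, hence U(x,l) for all x in Y, so p vanishes on Y.  This contradicts
    the density of Y. *)

Set Implicit Arguments.
Unset Strict Implicit.
Unset Printing Implicit Defensive.

Local Open Scope classical_set_scope.
Local Open Scope ring_scope.

(** * Polynomials vanishing on a box *)

Lemma poly_eq0_near (R : realFieldType) (q : {poly R}) (c e : R) :
  0 < e -> (forall t, `|t - c| < e -> q.[t] = 0) -> q = 0.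
Proof.
move=> e_gt0 q0; apply/eqP; apply: contraT => q_neq0.
(* One more root inside the interval than the degree of q allows. *)
pose rs := [seq c + e / (k.+2)%:R | k <- iota 0 (size q)].
have rs_uniq : uniq rs.
  rewrite map_inj_uniq ?iota_uniq // => a b /addrI /(mulfI (lt0r_neq0 e_gt0)).
  by move=> /invr_inj /eqP; rewrite eqr_nat => /eqP[].
have rs_roots : all (root q) rs.
  apply/allP => _ /mapP[k _ ->]; rewrite rootE q0 //.
  rewrite addrC addKr gtr0_norm ?divr_gt0 // ltr_pdivrMr // ltr_pMr //.
  by rewrite ltr1n.
have := max_poly_roots q_neq0 rs_roots rs_uniq.
by rewrite size_map size_iota ltnn.
Qed.

Lemma lift_ord_max (n : nat) (i : 'I_n) :
  lift ord_max i = widen_ord (leqnSn n) i.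
Proof. by apply: val_inj; rewrite /= /bump leqNgt ltn_ord. Qed.

Lemma mnm_rcons_max (n : nat) (m : 'X_{1..n}) (k : nat) :
  [multinom of rcons m k] ord_max = k.
Proof.
by rewrite multinomE (tnth_nth 0%N) /= nth_rcons size_tuple ltnn eqxx.
Qed.

Lemma mnm_rcons_widen (n : nat) (m : 'X_{1..n}) (k : nat) (i : 'I_n) :
  [multinom of rcons m k] (widen_ord (leqnSn n) i) = m i.
Proof.
by rewrite multinomE (tnth_nth 0%N) /= nth_rcons size_tuple ltn_ord -mnm_nth.
Qed.

Lemma mcoeff_muni (R : comNzRingType) (n : nat) (p : {mpoly R[n.+1]}) (k : nat)
    (m : 'X_{1..n}) :
  ((muni p)`_k)@_m = p@_[multinom of rcons m k].
Proof.
rewrite muniE coef_sum raddf_sum /= [in RHS](mpolyE p) raddf_sum /=.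
apply: eq_bigr => u _; rewrite coefZ coefXn [RHS]mcoeffZ mcoeffX.
rewrite mulr_natr raddfMn /= mcoeffZ mcoeffX -[_ *+ (k == _)]mulr_natr.
rewrite -mulrA -natrM mulnb andbC; congr (_ * (_ : bool)%:R).
apply/andP/eqP => [[/eqP kE /eqP mE]|->]; last first.
  split; apply/eqP; first by rewrite mnm_rcons_max.
  by apply/mnmP => i; rewrite mnmE mnm_rcons_widen.
apply/mnmP => i; case: (unliftP ord_max i) => [j|] ->; last first.
  by rewrite mnm_rcons_max.
by rewrite lift_ord_max mnm_rcons_widen -mE mnmE.
Qed.

Lemma horner_muni (R : comNzRingType) (n : nat) (p : {mpoly R[n.+1]})
    (v : 'I_n.+1 -> R) :
  (map_poly (meval (fun i => v (widen_ord (leqnSn n) i))) (muni p)).[v ord_max]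
  = p.@[v].
Proof.
rewrite muniE rmorph_sum /= horner_sum mevalE; apply: eq_bigr => m _.
rewrite map_polyZ /= map_polyXn hornerZ hornerXn mevalZ mevalX -mulrA.
rewrite big_ord_recr /=; congr (_ * (_ * _)).
by apply: eq_bigr => i _; rewrite mnmE.
Qed.

(** Induction on the number of variables: with all variables but the last
    fixed, p is a univariate polynomial vanishing on an interval, so each of its
    coefficients, a polynomial in the other variables, vanishes on the box. *)
Lemma mpoly_eq0_box (R : realFieldType) (n : nat) (p : {mpoly R[n]})
    (c : 'I_n -> R) (e : R) :
  0 < e -> (forall v, (forall i, `|v i - c i| < e) -> p.@[v] = 0) -> p = 0.
Proof.
move=> e_gt0; elim: n p c => [|n IHn] p c p0.
  have p_const : p = (p@_0)%:MP.
    by apply/mpolyP => m; rewrite mcoeffC (_ : m = 0%MM) ?eqxx ?mulr1 //;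
       apply/mnmP; case.
  have := p0 c; rewrite p_const mevalC => -> //; last by case.
pose w i := widen_ord (leqnSn n) i.
suff muni0 : muni p = 0.
  apply/mpolyP => m; rewrite mcoeff0.
  have -> : m = [multinom of rcons [multinom m (w i) | i < n] (m ord_max)].
    apply/mnmP => i; case: (unliftP ord_max i) => [j|] ->; last first.
      by rewrite mnm_rcons_max.
    by rewrite lift_ord_max -/(w j) mnm_rcons_widen mnmE.
  by rewrite -mcoeff_muni muni0 coef0 mcoeff0.
apply/polyP => k; rewrite coef0; apply: (IHn _ (c \o w)) => v vc.
have -> : ((muni p)`_k).@[v] = (map_poly (meval v) (muni p))`_k.
  by rewrite coef_map.
rewrite (@poly_eq0_near _ (map_poly (meval v) (muni p)) (c ord_max) e) //.
  by rewrite coef0.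
move=> t tc; pose u i := if unlift ord_max i is Some j then v j else t.
have u_max : u ord_max = t by rewrite /u unlift_none.
have u_w j : u (w j) = v j.
  by rewrite /u /w -lift_ord_max liftK.
have -> : map_poly (meval v) (muni p)
          = map_poly (meval (fun i => u (w i))) (muni p).
  by apply: eq_map_poly => q; apply: meval_eq => j; rewrite u_w.
rewrite -u_max horner_muni p0 // => i.
case: (unliftP ord_max i) => [j|] ->; last by rewrite u_max.
by rewrite lift_ord_max -/(w j) u_w; apply: vc.
Qed.
(** * Thin sets and interpolation *)

Definition evaluation (R : realType) (n : nat) (x : 'rV[R]_n)
    (p : {mpoly R[n]}) : R :=
  p.@[fun i => x ord0 i].

(** Thin sets are the subsets that are not Zariski-dense. *)
Definition thin (R : realType) (n : nat) (T : set 'rV[R]_n) : Prop :=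
  exists2 p : {mpoly R[n]}, p != 0 & forall x, T x -> evaluation x p = 0.

Lemma thinS (R : realType) (n : nat) (S T : set 'rV[R]_n) :
  S `<=` T -> thin T -> thin S.
Proof. by move=> ST [p p_neq0 pT]; exists p => // x /ST /pT. Qed.

Lemma thin0 (R : realType) (n : nat) : thin (set0 : set 'rV[R]_n).
Proof. by exists 1; rewrite ?oner_neq0. Qed.

(** Affine space is irreducible: the polynomials form an integral domain, so
    the product of the equations of the sets is an equation of their union. *)
Lemma thin_bigcup (R : realType) (n m : nat) (T : 'I_m -> set 'rV[R]_n) :
  (forall l, thin (T l)) -> thin (\bigcup_l T l).
Proof.
move=> T_thin.
have /choice[p pP] l : exists p : {mpoly R[n]},
    p != 0 /\ forall x, T l x -> evaluation x p = 0.
  by have [p ? ?] := T_thin l; exists p.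
exists (\prod_l p l).
  by apply/prodf_neq0 => l _; have [] := pP l.
move=> x [l _ /(proj2 (pP l))]; rewrite /evaluation => plx.
by rewrite rmorph_prod (bigD1 l) //= plx mul0r.
Qed.

(** The norm on row vectors is the maximum norm, whose balls are boxes. *)
Lemma thin_interior0 (R : realType) (n : nat) (T : set 'rV[R]_n) :
  thin T -> interior T = set0.
Proof.
move=> [p /eqP p_neq0 pT]; rewrite -subset0 => x.
move=> /nbhs_ballP[e /= e_gt0 xeT]; apply: p_neq0.
apply: (@mpoly_eq0_box _ _ p (fun i => x ord0 i) e) => // v vx.
rewrite -(pT (\row_i v i)); first by apply: meval_eq => i; rewrite mxE.
by apply: xeT; split=> // i j; rewrite ord1 mxE; rewrite /ball /= distrC.
Qed.

(** The conditions on p are [size ys] homogeneous linear equations in the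
    coefficients of p, and there are 'C(n + d, n) monomials of degree at most
    d. *)
Lemma interpolation (R : realType) (n d : nat) (ys : seq 'rV[R]_n) :
  (size ys < 'C(n + d, n))%N ->
  exists p : {mpoly R[n]},
    [/\ p != 0, (msize p <= d.+1)%N & forall y, y \in ys -> evaluation y p = 0].
Proof.
rewrite -card_partial_ord_partitions.
(* Monomials are encoded by their exponents, which are at most d, to match the
   count of bounded tuples with bounded sum. *)
set M := [set t : n.-tuple 'I_d.+1 | (\sum_(i <- t) i <= d)%N]%SET => lt_ys.
pose X (t : n.-tuple 'I_d.+1) := [multinom tnth t i : nat | i < n].
have X_inj : injective X.
  move=> s t /mnmP st; apply: eq_from_tnth => i; apply: val_inj.
  by have := st i; rewrite !mnmE.
pose V := \matrix_(i < #|M|, s < size ys)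
  evaluation (nth 0 ys s) 'X_[X (enum_val i)].
have : kermx V != 0.
  rewrite -mxrank_eq0 mxrank_ker subn_eq0 -ltnNge.
  exact: leq_ltn_trans (rank_leq_col V) lt_ys.
move=> /rowV0Pn[c /sub_kermxP cV /eqP c_neq0].
pose p := \sum_i c ord0 i *: 'X_[X (enum_val i)].
have p_coef i : p@_(X (enum_val i)) = c ord0 i.
  rewrite raddf_sum (bigD1 i) //= big1 ?addr0 => [|k ki].
    by rewrite mcoeffZ mcoeffX eqxx mulr1.
  rewrite mcoeffZ mcoeffX (inj_eq X_inj) (inj_eq enum_val_inj) (negPf ki).
  by rewrite mulr0.
exists p; split.
- apply/eqP => p0; apply: c_neq0; apply/rowP => i.
  by rewrite -p_coef p0 mcoeff0 mxE.
- apply: leq_trans (mmeasure_sum _ _ _ _) _; apply/bigmax_leqP => i _.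
  apply: leq_trans (msizeZ_le _ _) _; rewrite msizeX ltnS mdegE.
  have := enum_valP i; rewrite inE big_tuple.
  by apply: leq_trans; apply/eq_leq/eq_bigr => k _; rewrite mnmE.
move=> y y_ys.
have s_lt : (index y ys < size ys)%N by rewrite index_mem.
have := congr1 (fun B : 'rV_ _ => B ord0 (Ordinal s_lt)) cV; rewrite !mxE => <-.
rewrite /evaluation raddf_sum; apply: eq_bigr => i _.
by rewrite mxE /evaluation /= nth_index // mevalZ.
Qed.
(** * Finitely many points with generic spans *)

(** Among the large subsets Y of X and the families W of subspaces with
    [U x l] inside [W l] for x in Y, take a pair minimizing the sum of the
    dimensions.  By minimality, the points x of Y with [U x l] inside a given
    proper subspace of [W l] form a small set.  A point of Y outside the small
    sets attached to the spans reached so far therefore enlarges all the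
    spans that differ from [W l] simultaneously, and k such points
    suffice because the ambient dimension is k. *)
Lemma spanning_sample (F : fieldType) (T : eqType) (m k : nat)
    (small : set T -> Prop)
    (small0 : small set0)
    (small_bigcup : forall B : 'I_m -> set T,
        (forall l, small (B l)) -> small (\bigcup_l B l))
    (smallS : forall A B : set T, A `<=` B -> small B -> small A)
    (X : set T) (X_large : ~ small X) (U : T -> 'I_m -> 'M[F]_k) :
  exists (Y : set T) (ys : seq T),
    [/\ Y `<=` X, ~ small Y, size ys = k, forall y, y \in ys -> Y y
      & forall x l, Y x -> (U x l <= \sum_(y <- ys) U y l)%MS].
Proof.
pose hull (r : nat) := exists (Y : set T) (W : 'I_m -> 'M[F]_k),
  [/\ Y `<=` X, ~ small Y, forall x l, Y x -> (U x l <= W l)%MS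
    & (\sum_l \rank (W l))%N = r].
have hull_ex : exists r, `[< hull r >].
  exists (\sum_(l < m) \rank (1%:M : 'M[F]_k))%N; apply/asboolP.
  by exists X, (fun=> 1%:M); split=> // x l _; rewrite submx1.
case: (ex_minnP hull_ex) => r /asboolP[Y [W [YX Y_large UW Wr]]] r_min.
have proper_small l (V : 'M[F]_k) : (\rank V < \rank (W l))%N ->
    small [set x | Y x /\ (U x l <= V)%MS].
  move=> ltVW; apply: contrapT => large.
  pose W' i := if i == l then V else W i.
  have : (r <= \sum_i \rank (W' i))%N.
    apply/r_min/asboolP; exists [set x | Y x /\ (U x l <= V)%MS], W'.
    split=> // [x [/YX]//|x i [Yx UV]].
    by rewrite /W'; case: eqP => [->//|_]; apply: UW.
  apply/negP; rewrite -ltnNge -Wr (bigD1 l) //= [X in (_ < X)%N](bigD1 l) //=.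
  rewrite {1}/W' eqxx -addSn leq_add //; apply/eq_leq/eq_bigr => i /negPf il.
  by rewrite /W' il.
(* After s greedy choices, every span has dimension at least s or is
   complete. *)
have greedy s : exists ys : seq T, [/\ size ys = s, forall y, y \in ys -> Y y
    & forall l, (minn s (\rank (W l)) <= \rank (\sum_(y <- ys) U y l)%MS)%N].
  elim: s => [|s [ys [ys_size ysY ys_rank]]].
    by exists [::]; split=> // l; rewrite min0n.
  pose S l := (\sum_(y <- ys) U y l)%MS.
  pose bad l := [set x | (\rank (S l) < \rank (W l))%N /\
                         (Y x /\ (U x l <= S l)%MS)].
  have bad_small : small (\bigcup_l bad l).
    apply: small_bigcup => l.
    have [lt|ge] := boolP (\rank (S l) < \rank (W l))%N.
      by apply: smallS (proper_small l (S l) lt) => x [].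
    by apply: smallS small0 => x []; rewrite (negPf ge).
  have [x Yx x_good] : exists2 x, Y x & forall l, ~ bad l x.
    apply: contrapT => no_x; apply: Y_large; apply: smallS bad_small => x Yx.
    apply: contrapT => x_good; apply: no_x; exists x => // l lx.
    by apply: x_good; exists l.
  exists (x :: ys); split=> [|y|l]; first by rewrite /= ys_size.
    by rewrite inE => /predU1P[->//|/ysY].
  rewrite big_cons -/(S l).
  have [lt|ge] := ltnP (\rank (S l)) (\rank (W l)); last first.
    rewrite geq_min; apply/orP; right; apply: leq_trans ge _.
    exact/mxrankS/addsmxSr.
  have s_le : (s <= \rank (S l))%N.
    have := ys_rank l; rewrite -/(S l) geq_min => /orP[//|].
    by rewrite leqNgt lt.
  rewrite geq_min; apply/orP; left; apply: leq_ltn_trans s_le _.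
  apply: rank_ltmx; rewrite /ltmx addsmxSr /=; apply/negP => sub.
  apply: (x_good l); split=> //; split=> //.
  exact: submx_trans (addsmxSl _ _) sub.
have [ys [ys_size ysY ys_rank]] := greedy k.
exists Y, ys; split=> // x l Yx; apply: submx_trans (UW x l Yx) _.
have SW : (\sum_(y <- ys) U y l <= W l)%MS.
  rewrite big_seq; elim/big_ind: _ => [|A B AW BW|y /ysY Yy].
  - exact: sub0mx.
  - by rewrite addsmx_sub AW.
  - exact: UW.
have [_ <-] := mxrank_leqif_sup SW.
rewrite eqn_leq mxrankS //=.
by have := ys_rank l; rewrite (minn_idPr _) // rank_leq_col.
Qed.
(** * Positive semidefinite matrices *)

Definition bform (R : realType) (j : nat) (A : 'M[R]_j) (u v : 'cV[R]_j) : R :=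
  (u^T *m A *m v) ord0 ord0.

Definition psd (R : realType) (j : nat) (A : 'M[R]_j) : Prop :=
  A^T = A /\ forall v, 0 <= bform A v v.

Lemma bformDl (R : realType) (j : nat) (A : 'M[R]_j) (a b : R)
    (u v w : 'cV[R]_j) :
  bform A (a *: u + b *: v) w = a * bform A u w + b * bform A v w.
Proof. by rewrite /bform linearD !linearZ /= !mulmxDl -!scalemxAl !mxE. Qed.

Lemma bformDr (R : realType) (j : nat) (A : 'M[R]_j) (a b : R)
    (u v w : 'cV[R]_j) :
  bform A w (a *: u + b *: v) = a * bform A w u + b * bform A w v.
Proof. by rewrite /bform mulmxDr -!scalemxAr !mxE. Qed.

Lemma bform_mxD (R : realType) (j : nat) (a b : R) (A B : 'M[R]_j)
    (u v : 'cV[R]_j) :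
  bform (a *: A + b *: B) u v = a * bform A u v + b * bform B u v.
Proof. by rewrite /bform mulmxDr mulmxDl -!scalemxAr -!scalemxAl !mxE. Qed.

Lemma bform_sym (R : realType) (j : nat) (A : 'M[R]_j) (u v : 'cV[R]_j) :
  A^T = A -> bform A u v = bform A v u.
Proof.
move=> A_sym; rewrite /bform -[v^T *m A *m u]trmxK [RHS]mxE.
by rewrite !trmx_mul trmxK A_sym mulmxA.
Qed.

Lemma psd_cauchy_schwarz (R : realType) (j : nat) (A : 'M[R]_j)
    (u v : 'cV[R]_j) :
  psd A -> bform A u v ^+ 2 <= bform A u u * bform A v v.
Proof.
move=> [A_sym A_ge0].
have form_ge0 a b : 0 <= a ^+ 2 * bform A u u + 2 * a * b * bform A u v
                        + b ^+ 2 * bform A v v.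
  have := A_ge0 (a *: u + b *: v).
  by rewrite bformDl !bformDr (bform_sym v u A_sym); congr (_ <= _); ring.
have := A_ge0 v; rewrite le_eqVlt => /predU1P[v0|v_gt0].
  rewrite -v0 mulr0; have [->|uv_neq0] := eqVneq (bform A u v) 0.
    by rewrite expr0n.
  (* Along u + b v the form is affine in b; this b makes it equal to -1. *)
  have := form_ge0 1 (- (bform A u u + 1) / (2 * bform A u v)).
  rewrite -v0 mulr0 addr0 expr1n mul1r mulr1.
  have -> : 2 * (- (bform A u u + 1) / (2 * bform A u v)) * bform A u v
            = - (bform A u u + 1) by field; rewrite uv_neq0.
  by lra.
rewrite -subr_ge0 -(pmulr_lge0 _ v_gt0).
(* The component of u orthogonal to v for the form, scaled by the square norm
   of v. *)
have := form_ge0 (bform A v v) (- bform A u v).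
by congr (_ <= _); ring.
Qed.

Lemma bform_delta (R : realType) (j : nat) (A : 'M[R]_j)
    (i : 'I_j) (v : 'cV[R]_j) :
  bform A (delta_mx i ord0) v = (A *m v) i ord0.
Proof. by rewrite /bform trmx_delta -mulmxA -rowE mxE. Qed.

Lemma bform1E (R : realType) (j : nat) (u : 'cV[R]_j) :
  bform 1%:M u u = \sum_i u i ord0 ^+ 2.
Proof.
by rewrite /bform mulmx1 mxE; apply: eq_bigr => i _; rewrite mxE expr2.
Qed.

(** The i-th entry of A v is the value of the form at (e_i, v), so its square is
    at most A_ii times the form at (v, v); sum over i. *)
Lemma psd_norm_le (R : realType) (j : nat) (A : 'M[R]_j) (v : 'cV[R]_j) :
  psd A -> bform 1%:M (A *m v) (A *m v) <= \tr A * bform A v v.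
Proof.
move=> A_psd; rewrite bform1E /mxtrace mulr_suml; apply: ler_sum => i _.
have := psd_cauchy_schwarz (delta_mx i ord0) v A_psd.
by rewrite !bform_delta -colE [col _ _ _ _]mxE.
Qed.

Lemma psd_ker (R : realType) (j : nat) (A : 'M[R]_j) (v : 'cV[R]_j) :
  psd A -> bform A v v = 0 -> A *m v = 0.
Proof.
move=> /(psd_norm_le v) + v0; rewrite v0 mulr0 bform1E => norm_le0.
have sq_ge0 i : 0 <= (A *m v) i ord0 ^+ 2 by exact: sqr_ge0.
have /psumr_eq0P sq0 : \sum_i (A *m v) i ord0 ^+ 2 = 0.
  by apply/eqP; rewrite eq_le norm_le0 sumr_ge0.
apply/colP => i; rewrite [RHS]mxE; apply/eqP.
by rewrite -sqrf_eq0 sq0.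
Qed.

Lemma bform_le_norm (R : realType) (j : nat) (Y : 'M[R]_j) (u : 'cV[R]_j) :
  bform Y u u <= (\sum_i \sum_k `|Y i k|) * bform 1%:M u u.
Proof.
have u_le i : u i ord0 ^+ 2 <= bform 1%:M u u.
  rewrite bform1E (bigD1 i) //= lerDl; apply: sumr_ge0 => k _; exact: sqr_ge0.
move: (bform 1%:M u u) u_le => N u_le.
rewrite /bform -mulmxA mxE mulr_suml; apply: ler_sum => i _.
rewrite mxE [(Y *m u) _ _]mxE mulr_sumr mulr_suml; apply: ler_sum => k _.
have uu_le : `|u i ord0 * u k ord0| <= N.
  have := u_le i; have := u_le k; rewrite ler_norml.
  move: (u i ord0) (u k ord0) => a b.
  have := sqr_ge0 (a + b); have := sqr_ge0 (a - b); nra.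
apply: le_trans (ler_norm _) _; rewrite mulrCA normrM.
exact: ler_wpM2l.
Qed.

(** Since the kernel of A lies in that of B, B = A Y A for some matrix Y, so the
    form of B at v is the form of Y at A v.  The latter is bounded by a multiple
    of the square norm of A v, hence by a multiple of the form of A at v
    ([psd_norm_le]). *)
Lemma psd_dominates (R : realType) (j : nat) (A B : 'M[R]_j) :
  psd A -> B^T = B -> kermx A *m B = 0 ->
  exists2 c, 0 <= c & forall v, bform B v v <= c * bform A v v.
Proof.
move=> A_psd B_sym kerAB.
have [Y BE] : exists Y, B = A *m Y *m A.
  (* With A^+ the pseudo-inverse, the rows of 1 - A A^+ lie in the left kernel
     of A, which B annihilates. *)
  have BE : A *m pinvmx A *m B = B.
    have /submxP[D DE] : (1%:M - A *m pinvmx A <= kermx A)%MS.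
      by apply/sub_kermxP; rewrite mulmxBl mul1mx mulmxKpV // subrr.
    apply/esym/eqP; rewrite -subr_eq0 -[X in X - _]mul1mx -mulmxBl DE.
    by rewrite -mulmxA kerAB mulmx0.
  move: (pinvmx A) BE => P BE; exists (P *m B *m P^T).
  have := congr1 trmx BE; rewrite !trmx_mul B_sym (proj1 A_psd) mulmxA => BE'.
  by rewrite !mulmxA BE BE'.
pose c := \sum_i \sum_k `|Y i k|.
have c_ge0 : 0 <= c by do 2!apply: sumr_ge0 => ? _.
have tr_ge0 : 0 <= \tr A.
  apply: sumr_ge0 => i _; have := proj2 A_psd (delta_mx i ord0).
  by rewrite bform_delta -colE [col _ _ _ _]mxE.
exists (c * \tr A) => [|v]; first exact: mulr_ge0.
have -> : bform B v v = bform Y (A *m v) (A *m v).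
  by rewrite /bform BE trmx_mul (proj1 A_psd) !mulmxA.
apply: le_trans (bform_le_norm _ _) _.
by rewrite -/c -mulrA ler_wpM2l // psd_norm_le.
Qed.
(** * Faces of a semidefinite lift *)

Lemma psd_psd_cone (R : realType) (j : nat) (A : subvs_of (symmx R j)) :
  psd_cone A -> psd (vsval A).
Proof. by move=> A_psd; split=> //; apply/mem_symmx/subvsP. Qed.

(** On the kernel of the sum both forms vanish, as they are nonnegative and
    their positive combination is zero. *)
Lemma psd_kerD (R : realType) (j : nat) (a b : R) (A B : 'M[R]_j) :
  0 < a -> 0 < b -> psd A -> psd B ->
  (kermx (a *: A + b *: B) <= kermx A)%MS /\
  (kermx (a *: A + b *: B) <= kermx B)%MS.
Proof.
move=> a_gt0 b_gt0 A_psd B_psd.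
have ker0 (u : 'rV_j) : (u <= kermx (a *: A + b *: B))%MS ->
    u *m A = 0 /\ u *m B = 0.
  move=> /sub_kermxP uAB.
  have : bform (a *: A + b *: B) u^T u^T = 0.
    by rewrite /bform trmxK uAB mul0mx mxE.
  have := proj2 A_psd u^T; have := proj2 B_psd u^T.
  rewrite bform_mxD => B_ge0 A_ge0.
  move=> /eqP; rewrite paddr_eq0; last 2 first.
  - exact: mulr_ge0 (ltW a_gt0) A_ge0.
  - exact: mulr_ge0 (ltW b_gt0) B_ge0.
  rewrite !mulf_eq0 (gt_eqF a_gt0) (gt_eqF b_gt0) /=.
  move=> /andP[/eqP/(psd_ker A_psd) Au /eqP/(psd_ker B_psd) Bu].
  by split; apply: trmx_inj;
    rewrite trmx_mul trmx0 ?(proj1 A_psd) ?(proj1 B_psd).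
by split; apply/rV_subP => u /ker0[uA uB]; apply/sub_kermxP.
Qed.

Lemma affine_subspace_comb (R : realType) (E : vectType R) (H : set E)
    (a b : R) (x y : E) :
  affine_subspace H -> a + b = 1 -> H x -> H y -> H (a *: x + b *: y).
Proof.
move=> [o [W ->]] ab1 [v /= vW <-] [w /= wW <-].
exists (a *: v + b *: w); first by rewrite /= rpredD ?rpredZ.
by rewrite !scalerDr addrACA -scalerDl ab1 scale1r.
Qed.

(** The face of zeros of f has a point A0 whose blocks have kernels of least
    total dimension; U consists of these kernels.  They lie in the kernels of
    every other point A of the face, since otherwise the midpoint of A0 and A,
    which is in the face too, would have smaller kernels.  Conversely, if the
    kernels of A contain those of A0, then the segment from A to A0 can be
    prolonged beyond A0 inside the slice by [psd_dominates]; f is nonnegative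
    at its end, which lies on the other side of the zero A0 of f, and this
    forces f A = 0. *)
Lemma psd_lift_face (R : realType) (j m : nat)
    (H : set {ffun 'I_m -> subvs_of (symmx R j)})
    (f : {ffun 'I_m -> subvs_of (symmx R j)} -> R) :
  affine_subspace H ->
  (forall a b A B, f (a *: A + b *: B) = a * f A + b * f B) ->
  (forall A, (@psd_prod R j m `&` H) A -> 0 <= f A) ->
  (exists2 A, (@psd_prod R j m `&` H) A & f A = 0) ->
  exists U : 'I_m -> 'M[R]_j, forall A, (@psd_prod R j m `&` H) A ->
    (f A = 0 <-> forall l, U l *m vsval (A l) = 0).
Proof.
move=> H_aff f_lin f_ge0 [Z LZ fZ].
have vsval_comb a b (A B : {ffun 'I_m -> subvs_of (symmx R j)}) l :
    vsval ((a *: A + b *: B) l) = a *: vsval (A l) + b *: vsval (B l).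
  by rewrite !ffunE linearD !linearZ.
have nullity_ex : exists r, `[< exists A, [/\ (@psd_prod R j m `&` H) A, f A = 0
    & (\sum_l \rank (kermx (vsval (A l))))%N = r] >].
  by exists (\sum_l \rank (kermx (vsval (Z l))))%N; apply/asboolP; exists Z.
case: (ex_minnP nullity_ex) => r /asboolP[A0 [[A0_psd HA0] fA0 rA0]] r_min.
have psdA0 l : psd (vsval (A0 l)) by apply/psd_psd_cone/A0_psd.
exists (fun l => kermx (vsval (A0 l))) => A [A_psd HA].
have psdA l : psd (vsval (A l)) by apply/psd_psd_cone/A_psd.
split=> [fA l|kerA0A].
  pose h : R := 2^-1; have h_gt0 : 0 < h by rewrite invr_gt0.
  pose M := h *: A0 + h *: A.
  have ME k : vsval (M k) = h *: vsval (A0 k) + h *: vsval (A k).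
    exact: vsval_comb.
  have kerM k := psd_kerD h_gt0 h_gt0 (psdA0 k) (psdA k).
  have [] : (\sum_k \rank (kermx (vsval (M k))) <=
      \sum_k \rank (kermx (vsval (A0 k))) ?= iff
      [forall k, (kermx (vsval (A0 k)) <= kermx (vsval (M k)))%MS])%N.
    apply: leqif_sum => k _; apply: mxrank_leqif_sup.
    by rewrite ME; have [] := kerM k.
  rewrite rA0 eqn_leq => -> /=; rewrite r_min; last first.
    apply/asboolP; exists M; split=> //.
      2: by rewrite f_lin fA0 fA !mulr0 addr0.
    split; last by apply: affine_subspace_comb => //; rewrite /h; lra.
    move=> k v; rewrite ME -/(bform _ v v) bform_mxD.
    rewrite addr_ge0 // mulr_ge0 ?(ltW h_gt0) //.
    - exact: (proj2 (psdA0 k)).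
    - exact: (proj2 (psdA k)).
  move=> /esym/forallP/(_ l) A0M; apply/sub_kermxP; apply: submx_trans A0M _.
  by rewrite ME; have [] := kerM l.
have /choice[c cP] l : exists c, 0 <= c /\
    forall v, bform (vsval (A l)) v v <= c * bform (vsval (A0 l)) v v.
  have [c ? ?] := psd_dominates (psdA0 l) (proj1 (psdA l)) (kerA0A l).
  by exists c.
pose s := \sum_l c l.
have s_ge0 : 0 <= s by apply: sumr_ge0 => l _; have [] := cP l.
(* s dominates A by A0 in all blocks at once, and e s <= 1 keeps the prolonged
   segment inside the cone. *)
pose e := (1 + s)^-1.
have e_gt0 : 0 < e by rewrite invr_gt0; lra.
have es_le1 : e * s <= 1 by rewrite mulrC ler_pdivrMr; lra.
pose B := (1 + e) *: A0 + (- e) *: A.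
have /f_ge0 : (@psd_prod R j m `&` H) B.
  split; last by apply: affine_subspace_comb => //; lra.
  move=> l v; rewrite vsval_comb -/(bform _ v v) bform_mxD.
  have [_ /(_ v) c_le] := cP l; have A0v := proj2 (psdA0 l) v.
  have c_le_s : c l <= s.
    by rewrite /s (bigD1 l) //= lerDl; apply: sumr_ge0 => i _; have [] := cP i.
  have : bform (vsval (A l)) v v <= s * bform (vsval (A0 l)) v v.
    exact: le_trans c_le (ler_wpM2r A0v c_le_s).
  move: (bform _ v v) (bform _ v v) A0v => a0 a a0_ge0 a_le.
  have := ler_wpM2l (ltW e_gt0) a_le; rewrite mulrA => ea_le.
  have := ler_wpM2r a0_ge0 es_le1; rewrite mul1r => /(le_trans ea_le).
  have := mulr_ge0 (ltW e_gt0) a0_ge0; lra.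
rewrite f_lin fA0 mulr0 add0r mulNr oppr_ge0 pmulr_rle0 // => fA_le0.
by apply/eqP; rewrite eq_le fA_le0 f_ge0.
Qed.

(** * The lower bound *)

Lemma sqr_sos_polys (R : realType) (n d : nat) (p : {mpoly R[n]}) :
  (msize p <= d.+1)%N -> sos_polys (2 * d) (p ^+ 2).
Proof.
move=> p_le; split; last by exists [:: p]; rewrite big_seq1.
rewrite /polys_le /=; have [->|p_neq0] := eqVneq p 0.
  by rewrite expr0n msize0.
by rewrite expr2 msizeM //; move: (msize p) p_le => s; lia.
Qed.

(** A nonzero p of degree at most d that vanishes on the [j] points of a
    generic sample would vanish on a Zariski-dense set: the lift of p ^+ 2
    annihilates the subspaces attached to the sample, and these span the
    subspaces attached to all points of the dense set. *)
Lemma sdp_lift_size (R : realType) (n d j : nat) (X : set 'rV[R]_n)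
    (C : set {mpoly R[n]}) :
  interior X !=set0 -> @sos_polys R n (2 * d) `<=` C ->
  C `<=` nonneg_polys (2 * d) X -> has_sdp_lift C j -> ('C(n + d, n) <= j)%N.
Proof.
move=> X_int sosC CX [_ [m [_ [H [pi [H_aff CE]]]]]].
rewrite leqNgt; apply/negP => lt_j.
have X_large : ~ thin X.
  by move=> /thin_interior0 X0; case: X_int => x; rewrite X0.
have sq_lift p : (msize p <= d.+1)%N ->
    exists2 A, (@psd_prod R j m `&` H) A & pi A = p ^+ 2.
  by move=> /sqr_sos_polys /sosC; rewrite CE.
have /choice[U UP] x : exists U : 'I_m -> 'M[R]_j, X x ->
    forall A, (@psd_prod R j m `&` H) A ->
    (evaluation x (pi A) = 0 <-> forall l, U l *m vsval (A l) = 0).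
  have [Xx|nXx] := pselect (X x); last by exists (fun=> 0).
  have [|a b A B|A LA||U UP] :=
    @psd_lift_face R j m H (fun A => evaluation x (pi A)).
  - exact: H_aff.
  - by rewrite linearD !linearZ /evaluation mevalD !mevalZ.
  - by have /CX[_ /(_ _ Xx)] : C (pi A) by rewrite CE; exists A.
  - have [|Z LZ piZ] := sq_lift 0; first by rewrite msize0.
    by exists Z; rewrite // piZ /evaluation expr0n meval0.
  by exists U.
have [Y [ys [YX Y_large ys_size ysY Y_span]]] :=
  spanning_sample (@thin0 R n) (@thin_bigcup R n m) (@thinS R n) X_large U.
have [p [p_neq0 p_size p_ys]] : exists p : {mpoly R[n]}, [/\ p != 0,
    (msize p <= d.+1)%N & forall y, y \in ys -> evaluation y p = 0].
  by apply: interpolation; rewrite ys_size.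
have [A LA piA] := sq_lift p p_size.
have sq0 x : evaluation x (pi A) = 0 <-> evaluation x p = 0.
  rewrite piA /evaluation rmorphXn /=.
  by split=> [/eqP|->]; rewrite ?expr0n // sqrf_eq0 => /eqP.
apply: Y_large; exists p => // x Yx; apply/sq0/(UP x (YX x Yx) A LA) => l.
apply/sub_kermxP; apply: submx_trans (Y_span x l Yx) _.
rewrite big_seq; elim/big_ind: _ => [|V W VA WA|y y_ys]; first exact: sub0mx.
  by rewrite addsmx_sub VA.
by apply/sub_kermxP/(proj1 (UP y (YX y (ysY y y_ys)) A LA))/sq0/p_ys.
Qed.

Theorem corollary3 (R : realType) (n d : nat) (n_gt0 : (0 < n)%N)
  (X : set 'rV[R]_n) (X_int : interior X !=set0)
  (C : set {mpoly R[n]})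
  (C_closed : closed_polys (2 * d)%N C)
  (C_cone : convex_cone C)
  (sos_C : @sos_polys R n (2 * d)%N `<=` C)
  (C_nonneg : C `<=` nonneg_polys (2 * d)%N X) :
  ('C(n + d, n)%:R%:E <= sxdeg C)%E.
Proof.
rewrite /sxdeg; case: pselect => [hj|_]; last exact: leey.
case: ex_minnP => j /asboolP C_lift _.
by rewrite lee_fin ler_nat (sdp_lift_size X_int sos_C).
Qed.
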